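(* Let $X$ be a Hilbert space, and let $Z\in B(X)$ be of generalized index zero, with associated continuous isomorphism $\theta:\ker(Z)\to\operatorname{coker}(Z)$. Then there is some invertible $U\in B(X)^\times$, which is also a partial isometry, such that $$Z=U\sqrt{Z^*Z}.$$ Furthermore, if $\theta$ is an isometry, then $U$ is unitary.
   Context: $B(X)$ is the Banach algebra of bounded linear operators on the complex Hilbert space $X$, and $B(X)^\times$ its group of invertible elements. $\operatorname{coker}(Z)=X/\operatorname{im}(Z)$ carries the quotient norm. An operator $Z\in B(X)$ is of generalized index zero if there exists a continuous isomorphism $\theta:\ker(Z)\to\operatorname{coker}(Z)$, i.e. a linear bijection that is a homeomorphism; in particular, such a $Z$ has closed image. *)

(* Defs.v *)
From HB Require Import structures.
From mathcomp Require Import all_boot all_order all_algebra.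
From mathcomp Require Import all_classical all_reals all_analysis.
From mathcomp.real_closed Require Import complex.

Set Implicit Arguments.
Unset Strict Implicit.
Unset Printing Implicit Defensive.

Import Order.TTheory GRing.Theory Num.Theory.
Import numFieldNormedType.Exports.

Local Open Scope classical_set_scope.
Local Open Scope ring_scope.
Local Open Scope quotient_scope.

Reserved Notation "{ 'bounded' V -> W }"
  (at level 0, V at level 98, W at level 99, format "{ 'bounded'  V  ->  W }").
Reserved Notation "''[' x , y ]" (at level 0, format "''[' x ,  y ]").

(* The inner product of a `{dot X for Num.conj}` is linear in its first        *)
(* argument and conjugate-linear in the second one.  The order on `R[i]` makes *)
(* `0 <= z` mean that `z` is a nonnegative real number.                        *)
HB.mixin Record CompleteNormedModule_isHilbert (R : realType) (X : Type)
    of CompleteNormedModule R[i] X := {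
  hdot : {dot X for (@Num.conj R[i])};
  hdot_norm : forall x : X, hdot x x = `|x| ^+ 2
}.

#[short(type="hilbertType")]
HB.structure Definition Hilbert (R : realType) :=
  {X of CompleteNormedModule_isHilbert R X & CompleteNormedModule R[i] X}.

Notation "''[' x , y ]" := (hdot x y) : ring_scope.

#[short(type="boundedType")]
HB.structure Definition BoundedLinear (K : numDomainType)
    (V W : normedModType K) :=
  {f of @GRing.Linear K V W *:%R f & @isContinuous V W f}.

Notation "{ 'bounded' V -> W }" := (@BoundedLinear.type _ V%type W%type)
  : type_scope.

HB.instance Definition _ (K : numDomainType) (V W : normedModType K) :=
  gen_eqMixin {bounded V -> W}.
HB.instance Definition _ (K : numDomainType) (V W : normedModType K) :=
  gen_choiceMixin {bounded V -> W}.

Section BoundedOperators.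
Variables (K : numDomainType) (U V W : normedModType K).

Lemma null_fun_continuous : continuous (\0 : V -> W).
Proof. by move=> x; exact: cvg_cst. Qed.
HB.instance Definition _ :=
  isContinuous.Build V W (\0 : V -> W) null_fun_continuous.

Lemma idfun_continuous : continuous (idfun : V -> V).
Proof. by move=> x; exact: cvg_id. Qed.
HB.instance Definition _ := isContinuous.Build V V idfun idfun_continuous.

Lemma bounded_comp_continuous (f : {bounded V -> W}) (g : {bounded U -> V}) :
  continuous (f \o g).
Proof. by move=> x; apply: continuous_comp; exact: cts_fun. Qed.
HB.instance Definition _ (f : {bounded V -> W}) (g : {bounded U -> V}) :=
  isContinuous.Build U W (f \o g) (@bounded_comp_continuous f g).

Definition bounded0 : {bounded V -> W} := \0.
Definition bounded1 : {bounded V -> V} := idfun.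
Definition bounded_comp (f : {bounded V -> W}) (g : {bounded U -> V})
  : {bounded U -> W} := f \o g.

End BoundedOperators.

Section Kernel.
Variables (R : realType) (V W : normedModType R[i]) (Z : {linear V -> W}).

Definition ker_pred : {pred V} := [pred x | Z x == 0].

Lemma ker_pred_submod : submod_closed ker_pred.
Proof.
split; first by rewrite inE linear0.
by move=> a x y; rewrite !inE linearP => /eqP-> /eqP->; rewrite scaler0 addr0.
Qed.
HB.instance Definition _ := GRing.isSubmodClosed.Build R[i] V ker_pred
  ker_pred_submod.

Record ker : Type := Ker { ker_val : V; _ : ker_val \in ker_pred }.
HB.instance Definition _ := [isSub for ker_val].
HB.instance Definition _ := [Choice of ker by <:].
HB.instance Definition _ := [SubChoice_isSubZmodule of ker by <:].
HB.instance Definition _ := [SubZmodule_isSubLmodule of ker by <:].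

Definition ker_norm (x : ker) : R[i] := `|val x|.

Lemma ker_ler_normD (x y : ker) :
  ker_norm (x + y) <= ker_norm x + ker_norm y.
Proof. by rewrite /ker_norm raddfD/=; exact: ler_normD. Qed.

Lemma ker_normrZ (a : R[i]) (x : ker) : ker_norm (a *: x) = `|a| * ker_norm x.
Proof. by rewrite /ker_norm linearZ/= normrZ. Qed.

Lemma ker_normr0_eq0 (x : ker) : ker_norm x = 0 -> x = 0.
Proof. by move=> /normr0_eq0 x0; apply/val_inj; rewrite raddf0. Qed.

HB.instance Definition _ := Lmodule_isNormed.Build R[i] ker
  ker_ler_normD ker_normrZ ker_normr0_eq0.

End Kernel.

Section Cokernel.
Variables (R : realType) (V W : normedModType R[i]) (Z : {linear V -> W}).

Definition im_pred : {pred W} := [pred y | y \in range Z].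

Lemma im_pred_submod : submod_closed im_pred.
Proof.
split; first by rewrite !inE; exists 0; rewrite ?linear0.
move=> a x y; rewrite !inE => -[u _ <-] [v _ <-].
by exists (a *: u + v); rewrite ?linearP.
Qed.
HB.instance Definition _ := GRing.isSubmodClosed.Build R[i] W im_pred
  im_pred_submod.

Definition coker : Type := Quotient.quot im_pred.
HB.instance Definition _ := GRing.Zmodule.on coker.
HB.instance Definition _ := EqQuotient.on coker.

Lemma coker_eqP (x y : W) :
  reflect (\pi_coker x = \pi_coker y) (x - y \in im_pred).
Proof.
by rewrite Quotient.idealrBE; apply: (iffP eqP). Qed.

Definition coker_scale (a : R[i]) (q : coker) : coker := \pi_coker (a *: repr q).

Lemma coker_piZ (a : R[i]) (x : W) :
  coker_scale a (\pi_coker x) = \pi_coker (a *: x).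
Proof.
apply/coker_eqP; rewrite -scalerBr rpredZ//.
by apply/coker_eqP; rewrite reprK.
Qed.

Lemma coker_piD (x y : W) : \pi_coker (x + y) = \pi_coker x + \pi_coker y.
Proof. exact: Quotient.pi_add. Qed.

Lemma coker_piN (x : W) : \pi_coker (- x) = - \pi_coker x.
Proof. exact: Quotient.pi_opp. Qed.

Lemma coker_scaleA a b q :
  coker_scale a (coker_scale b q) = coker_scale (a * b) q.
Proof.
rewrite -[q]reprK (coker_piZ b) (coker_piZ (a * b)).
by rewrite (coker_piZ a (b *: _)) scalerA.
Qed.

Lemma coker_scale1 : left_id 1 coker_scale.
Proof. by move=> q; rewrite -[q]reprK coker_piZ scale1r. Qed.

Lemma coker_scaleDr : right_distributive coker_scale +%R.
Proof.
move=> a p q; rewrite -[p]reprK -[q]reprK.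
rewrite -coker_piD (coker_piZ a (_ + _)) !(coker_piZ a (repr _)).
by rewrite scalerDr coker_piD.
Qed.

Lemma coker_scaleDl q : {morph coker_scale^~ q : a b / a + b}.
Proof.
by move=> a b; rewrite -[q]reprK !coker_piZ scalerDl coker_piD.
Qed.

HB.instance Definition _ := GRing.Zmodule_isLmodule.Build R[i] coker
  coker_scaleA coker_scale1 coker_scaleDr coker_scaleDl.

(* Norms of spaces over `R[i]` take their values in `R[i]`, where infima are   *)
(* not available; the infimum is therefore taken in `R`.                       *)
Definition coset_norms (q : coker) : set R :=
  [set r | exists2 y : W, \pi_coker y = q & `|y| = r%:C%C].

Definition coker_norm (q : coker) : R[i] := (inf (coset_norms q))%:C%C.

Lemma normC_real (y : W) : `|y| = (complex.Re `|y|)%:C%C.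
Proof.
have : `|y| \is Num.real by exact: normr_real.
by move=> /complex_realP[r ->].
Qed.

Lemma coset_norms_has_inf q : has_inf (coset_norms q).
Proof.
split.
  by exists (complex.Re `|repr q|), (repr q); rewrite ?reprK// -normC_real.
exists 0 => r [y _ yr].
by rewrite -lecR -yr normr_ge0.
Qed.

Lemma coker_ler_normD p q : coker_norm (p + q) <= coker_norm p + coker_norm q.
Proof.
rewrite /coker_norm -rmorphD/= lecR.
rewrite -inf_sumE; [|exact: coset_norms_has_inf..].
apply: lb_le_inf.
  have [[r pr] _] := coset_norms_has_inf p.
  have [[s qs] _] := coset_norms_has_inf q.
  by exists (r + s), r => //; exists s.
move=> _ [r [x <- xr] [s [y <- ys] <-]].
apply: (@le_trans _ _ (complex.Re `|x + y|)).
  apply: ge_inf.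
    by have [_] := coset_norms_has_inf (\pi_coker x + \pi_coker y).
  by exists (x + y); rewrite ?coker_piD// -normC_real.
by rewrite -lecR -normC_real rmorphD/= -xr -ys ler_normD.
Qed.

Lemma coker_normrN q : coker_norm (- q) = coker_norm q.
Proof.
rewrite /coker_norm; congr (_ (inf _)); apply/seteqP; split=> r [y].
  by move=> yq yr; exists (- y); rewrite ?coker_piN ?yq ?opprK ?normrN.
by move=> <- yr; exists (- y); rewrite ?coker_piN ?normrN.
Qed.

Lemma coker_norm_ge0 q : 0 <= coker_norm q.
Proof.
rewrite /coker_norm lecR; apply: lb_le_inf.
  by have [] := coset_norms_has_inf q.
by move=> r [y _ yr]; rewrite -lecR -yr normr_ge0.
Qed.

Lemma coker_norm_pi_le x : coker_norm (\pi_coker x) <= `|x|.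
Proof.
rewrite /coker_norm [leRHS]normC_real lecR; apply: ge_inf.
  by have [] := coset_norms_has_inf (\pi_coker x).
by exists x; rewrite -?normC_real.
Qed.

Lemma coker_norm0 : coker_norm 0 = 0.
Proof.
apply/eqP; rewrite eq_le coker_norm_ge0 andbT.
have <- : \pi_coker 0 = 0.
  by rewrite -[X in \pi_coker X](subrr 0) coker_piD coker_piN subrr.
by rewrite (le_trans (coker_norm_pi_le _))// normr0.
Qed.

Lemma coker_normrZ (a : R[i]) q : coker_norm (a *: q) = `|a| * coker_norm q.
Proof.
have [->|a0] := eqVneq a 0; first by rewrite scale0r normr0 mul0r coker_norm0.
have le b p : b != 0 -> coker_norm (b *: p) <= `|b| * coker_norm p.
  move=> b0; rewrite -ler_pdivrMl ?normr_gt0//.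
  have bE : `|b| = (complex.Re `|b|)%:C%C.
    by have /complex_realP[r ->] : `|b| \is Num.real by exact: normr_real.
  have bgt0 : 0 < complex.Re `|b| by rewrite -ltcR -bE normr_gt0.
  rewrite bE -fmorphV -rmorphM/= lecR; apply: lb_le_inf.
    by have [] := coset_norms_has_inf p.
  move=> r [y yp yr]; rewrite ler_pdivrMl//.
  apply: ge_inf; first by have [] := coset_norms_has_inf (b *: p).
  exists (b *: y); first by rewrite -yp -coker_piZ.
  by rewrite normrZ rmorphM/= -yr -bE.
apply/eqP; rewrite eq_le le//=.
have := le a^-1 (a *: q); rewrite invr_eq0 => /(_ a0).
by rewrite scalerK// normfV ler_pdivlMl ?normr_gt0.
Qed.

Lemma coker_normrMn q n : coker_norm (q *+ n) = coker_norm q *+ n.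
Proof. by rewrite -scaler_nat coker_normrZ normr_nat mulr_natl. Qed.

HB.instance Definition _ := Num.Zmodule_isSemiNormed.Build R[i] coker
  coker_ler_normD coker_normrMn coker_normrN.

Let coker_ball (p : coker) (e : R[i]) : set coker := ball_ Num.norm p e.
Let coker_ent : set_system (coker * coker) := entourage_ coker_ball.
Let coker_nbhs (p : coker) : set_system coker := nbhs_ coker_ent p.

HB.instance Definition _ := hasNbhs.Build coker coker_nbhs.

Let coker_nbhsE : nbhs = nbhs_ coker_ent. Proof. by []. Qed.

Let coker_ball_center p (e : R[i]) : 0 < e -> coker_ball p e p.
Proof. by rewrite /coker_ball/= subrr [`|0|]coker_norm0. Qed.

Let coker_ball_sym p q (e : R[i]) : coker_ball p e q -> coker_ball q e p.
Proof. by rewrite /coker_ball/= -normrN opprB. Qed.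

Let coker_ball_triangle p q r (e1 e2 : R[i]) :
  coker_ball p e1 q -> coker_ball q e2 r -> coker_ball p (e1 + e2) r.
Proof.
rewrite /coker_ball/= => pq qr; rewrite -(subrK q p) -addrA.
by rewrite (le_lt_trans (ler_normD _ _))// ltrD.
Qed.

HB.instance Definition _ := @Nbhs_isPseudoMetric.Build R[i] coker coker_ent
  coker_nbhsE coker_ball coker_ball_center coker_ball_sym coker_ball_triangle
  erefl.

End Cokernel.

Section GeneralizedIndexZero.
Variables (R : realType) (X : hilbertType R) (Z : {bounded X -> X}).

Definition continuous_isomorphism (theta : {linear ker Z -> coker Z}) : Prop :=
  continuous theta /\
  exists thetaV : coker Z -> ker Z,
    [/\ cancel theta thetaV, cancel thetaV theta & continuous thetaV].

Definition isometric (theta : {linear ker Z -> coker Z}) : Prop :=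
  forall x : ker Z, `|theta x| = `|x|.

End GeneralizedIndexZero.

Section HilbertOperators.
Variables (R : realType) (X : hilbertType R).
Implicit Types T U : {bounded X -> X}.

(* By the Riesz representation theorem there is exactly one such operator, so  *)
(* the default value of `xget` is never used.                                  *)
Definition adjoint T : {bounded X -> X} :=
  xget (bounded0 X X)
    [set S : {bounded X -> X} | forall x y, '[T x, y] = '[x, S y]].

(* On a complex Hilbert space this condition forces `T` to be self-adjoint.    *)
Definition positive_op T : Prop := forall x : X, 0 <= '[T x, x].

(* A positive operator has exactly one positive square root.                   *)
Definition sqrt_op T : {bounded X -> X} :=
  xget (bounded0 X X)
    [set S : {bounded X -> X} | positive_op S /\ bounded_comp S S = T].

Definition invertible_op U : Prop :=
  exists V : {bounded X -> X},
    bounded_comp U V = bounded1 X /\ bounded_comp V U = bounded1 X.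

Definition partial_isometry U : Prop :=
  forall x : X, (forall y : X, U y = 0 -> '[x, y] = 0) -> `|U x| = `|x|.

Definition unitary_op U : Prop :=
  bounded_comp (adjoint U) U = bounded1 X /\
  bounded_comp U (adjoint U) = bounded1 X.

End HilbertOperators.

(* Main.v *)
(* An invertible partial isometry is automatically unitary, so U has to be
   unitary whether or not theta is isometric.  Composing the projection onto
   ker Z, theta, and the identification of coker Z with the orthogonal
   complement of im Z yields T in B(X) that vanishes on the complement of ker Z,
   is injective on ker Z, and has range the complement of im Z.  With
   H = sqrt(Z^* Z) and K = sqrt(T^* T), the vectors H u and K v are orthogonal,
   as are Z u and T v, so H u + K v |-> Z u + T v is isometric; its domain and
   its range have zero orthogonal complement, hence it extends to a unitary U,
   and v = 0 gives U H = Z. *)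

Require Import Defs.
From HB Require Import structures.
From mathcomp Require Import all_boot all_order all_algebra.
From mathcomp Require Import all_classical all_reals all_analysis.
From mathcomp.real_closed Require Import complex.
From mathcomp Require Import ring lra.

Set Implicit Arguments.
Unset Strict Implicit.
Unset Printing Implicit Defensive.

Import Order.TTheory GRing.Theory Num.Theory.
Import numFieldNormedType.Exports.

Local Open Scope classical_set_scope.
Local Open Scope ring_scope.

(** * Real-valued norms and bounded operators *)
Section RealNorm.
Variables (R : realType) (V : normedModType R[i]).

Definition rnorm (x : V) : R := complex.Re `|x|.

Lemma rnormE (x : V) : `|x| = (rnorm x)%:C%C.
Proof.
have /complex_realP[r xr] : `|x| \is Num.real by exact: normr_real.
by rewrite /rnorm xr.
Qed.

Lemma rnorm_ge0 (x : V) : 0 <= rnorm x.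
Proof. by rewrite -lecR -rnormE normr_ge0. Qed.

Lemma rnorm0 : rnorm 0 = 0.
Proof. by rewrite /rnorm normr0. Qed.

Lemma rnormN (x : V) : rnorm (- x) = rnorm x.
Proof. by rewrite /rnorm normrN. Qed.

Lemma rnormB (x y : V) : rnorm (x - y) = rnorm (y - x).
Proof. by rewrite -rnormN opprB. Qed.

Lemma rnorm_eq0 (x : V) : rnorm x = 0 -> x = 0.
Proof. by move=> x0; apply/normr0_eq0; rewrite rnormE x0. Qed.

Lemma ler_rnormD (x y : V) : rnorm (x + y) <= rnorm x + rnorm y.
Proof. by rewrite -lecR rmorphD/= -!rnormE ler_normD. Qed.

Lemma ler_rnorm_dist (x y z : V) :
  rnorm (x - z) <= rnorm (x - y) + rnorm (y - z).
Proof.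
have -> : x - z = (x - y) + (y - z) by rewrite addrA subrK.
exact: ler_rnormD.
Qed.

Lemma rnormZ (r : R) (x : V) : rnorm (r%:C%C *: x) = `|r| * rnorm x.
Proof.
apply: complexI; rewrite rmorphM/= -!rnormE normrZ.
by rewrite normc_def/= expr0n addr0 sqrtr_sqr.
Qed.

End RealNorm.

Lemma posC_real (R : realType) (e : R[i]) : 0 < e -> e = (complex.Re e)%:C%C.
Proof. by move=> /gtr0_real/complex_realP[r ->]. Qed.

Lemma invS_small (R : realType) (e : R) :
  0 < e -> exists n : nat, n.+1%:R^-1 < e.
Proof.
move=> e0; exists (Num.bound e^-1).
rewrite invf_plt ?posrE//.
apply: lt_trans (archi_boundP _) _; rewrite ?invr_ge0 ?ltW//.
by rewrite ltr_nat.
Qed.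

(** Sequential limits below are all taken here, with explicit rates. Completeness gives the limit,
    and comparison with a far term [u (maxn N n)] carries the rate [a] over to it. *)
Lemma complete_rate (R : realType) (V : completeNormedModType R[i])
    (u : nat -> V) (a : nat -> R) :
  (forall n m, (n <= m)%N -> rnorm (u n - u m) <= a n) ->
  (forall e, 0 < e -> exists n, a n < e) ->
  exists l, forall n, rnorm (u n - l) <= a n.
Proof.
move=> ua a0.
have /cvg_ex[l ul] : cvg (u @ \oo).
  apply: cauchy_cvg; apply: cauchy_exP => e e0.
  have [n an] : exists n, a n < complex.Re e.
    by apply: a0; rewrite -ltcR -posC_real.
  exists (u n), n => // m /= nm.
  by rewrite -ball_normE/= rnormE (posC_real e0) ltcR (le_lt_trans (ua _ _ nm)).
exists l => n; apply/ler_addgt0Pr => e e0.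
have eC : 0 < e%:C%C :> R[i] by rewrite ltcR.
have /cvgrPdist_lt/(_ _ eC)[N _ Nl] := ul.
apply: le_trans (ler_rnorm_dist _ (u (maxn N n)) _) _.
rewrite lerD ?ua ?leq_maxr//.
have := Nl (maxn N n) (leq_maxl _ _).
by rewrite rnormE ltcR rnormB => /ltW.
Qed.

Section BoundedOps.
Variables (R : realType) (V W : normedModType R[i]).

Lemma bounded_ext (F G : {bounded V -> W}) : F =1 G -> F = G.
Proof.
move: F G => [f [[f1] [f2] [f3]]] [g [[g1] [g2] [g3]]] /= /funext fg.
subst g.
by rewrite (Prop_irrelevance f1 g1) (Prop_irrelevance f2 g2)
  (Prop_irrelevance f3 g3).
Qed.

Lemma bounded_linearP (F : {bounded V -> W}) a x y : F (a *: x + y) = a *: F x + F y.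
Proof. exact: linearP. Qed.

Lemma bounded_linearB (F : {bounded V -> W}) x y : F (x - y) = F x - F y.
Proof. exact: linearB. Qed.

Lemma bounded_linearZ (F : {bounded V -> W}) a x : F (a *: x) = a *: F x.
Proof. exact: linearZ. Qed.

Lemma bounded_linear0 (F : {bounded V -> W}) : F 0 = 0.
Proof. exact: linear0. Qed.

Lemma bounded_bound (F : {bounded V -> W}) :
  exists c : R, 0 <= c /\ forall x, rnorm (F x) <= c * rnorm x.
Proof.
have /linear_bounded_continuous/linear_boundedP/pinfty_ex_gt0[c c0 cF] :
  continuous F by exact: cts_fun.
exists (complex.Re c); split; first by rewrite -lecR -(posC_real c0); exact: ltW.
by move=> x; rewrite -lecR rmorphM/= -!rnormE -(posC_real c0); exact: cF.
Qed.

Lemma bounded_mk (f : V -> W) (c : R) : linear f ->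
  (forall x, rnorm (f x) <= c * rnorm x) ->
  exists F : {bounded V -> W}, forall x, F x = f x.
Proof.
move=> lf cf.
pose fL : {linear V -> W} := HB.pack f (GRing.isLinear.Build _ _ _ _ f lf).
have fc : continuous f.
  apply: (@bounded_linear_continuous _ _ _ fL); apply/linear_boundedP.
  exists c%:C%C; split; first by rewrite complex_real.
  move=> r cr x /=; rewrite !rnormE; apply: (@le_trans _ _ (c * rnorm x)%:C%C).
    by rewrite lecR.
  by rewrite rmorphM/= ler_wpM2r ?lecR ?rnorm_ge0// ltW.
pose F : {bounded V -> W} := HB.pack f fL (isContinuous.Build _ _ f fc).
by exists F.
Qed.

End BoundedOps.

(** * Real part of the inner product *)

Lemma ReD (R : rcfType) (z w : R[i]) :
  complex.Re (z + w) = complex.Re z + complex.Re w.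
Proof. by case: z w => a b []. Qed.

Lemma ReN (R : rcfType) (z : R[i]) : complex.Re (- z) = - complex.Re z.
Proof. by case: z. Qed.

Lemma ReZ (R : rcfType) (r : R) (z : R[i]) :
  complex.Re (r%:C%C * z) = r * complex.Re z.
Proof. by case: z => a b /=; rewrite mul0r subr0. Qed.

Lemma Re_conj (R : rcfType) (z : R[i]) : complex.Re (conjc z) = complex.Re z.
Proof. by case: z. Qed.

Lemma Re_conji (R : rcfType) (z : R[i]) :
  complex.Re (conjc 'i%C * z) = complex.Im z.
Proof. by case: z => a b /=; rewrite mul0r sub0r mulN1r opprK. Qed.

Section RealDot.
Variables (R : realType) (X : hilbertType R).
Implicit Types (x y z : X) (r : R).

(** Real parts turn estimates into real inequalities for [lra] and [nra]. The complex value is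
    recovered from [rdot x y] and [rdot x ('i *: y)], the latter being the imaginary part. *)
Definition rdot x y : R := complex.Re '[x, y].

Lemma hdotC x y : '[x, y] = conjc '[y, x].
Proof. by have := hermC (@hdot R X) x y; rewrite expr0 mul1r; exact. Qed.

Lemma hdotDl x y z : '[x + y, z] = '[x, z] + '[y, z].
Proof. exact: linearDl. Qed.

Lemma hdotBl x y z : '[x - y, z] = '[x, z] - '[y, z].
Proof. exact: linearBl. Qed.

Lemma hdotZl a x y : '[a *: x, y] = a * '[x, y].
Proof. exact: linearZl_LR. Qed.

Lemma hdotDr x y z : '[x, y + z] = '[x, y] + '[x, z].
Proof. exact: linearDr. Qed.

Lemma hdotBr x y z : '[x, y - z] = '[x, y] - '[x, z].
Proof. exact: linearBr. Qed.

Lemma hdotZr a x y : '[x, a *: y] = conjc a * '[x, y].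
Proof. exact: linearZr_LR. Qed.

Lemma rdotC x y : rdot x y = rdot y x.
Proof. by rewrite /rdot hdotC Re_conj. Qed.

Lemma rdotDl x y z : rdot (x + y) z = rdot x z + rdot y z.
Proof. by rewrite /rdot hdotDl ReD. Qed.

Lemma rdotDr x y z : rdot x (y + z) = rdot x y + rdot x z.
Proof. by rewrite ![rdot x _]rdotC rdotDl. Qed.

Lemma rdotNl x y : rdot (- x) y = - rdot x y.
Proof. by rewrite /rdot linearNl; exact: ReN. Qed.

Lemma rdotNr x y : rdot x (- y) = - rdot x y.
Proof. by rewrite rdotC rdotNl rdotC. Qed.

Lemma rdotBl x y z : rdot (x - y) z = rdot x z - rdot y z.
Proof. by rewrite rdotDl rdotNl. Qed.

Lemma rdotBr x y z : rdot x (y - z) = rdot x y - rdot x z.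
Proof. by rewrite rdotDr rdotNr. Qed.

Lemma rdotZl r x y : rdot (r%:C%C *: x) y = r * rdot x y.
Proof. by rewrite /rdot hdotZl ReZ. Qed.

Lemma rdotZr r x y : rdot x (r%:C%C *: y) = r * rdot x y.
Proof. by rewrite rdotC rdotZl rdotC. Qed.

Lemma rdot0l x : rdot 0 x = 0.
Proof. by rewrite /rdot linear0l. Qed.

Lemma rdot0r x : rdot x 0 = 0.
Proof. by rewrite rdotC rdot0l. Qed.

Lemma rdotxx x : rdot x x = rnorm x ^+ 2.
Proof. by rewrite /rdot hdot_norm rnormE -rmorphXn. Qed.

Lemma Im_hdot x y : complex.Im '[x, y] = rdot x ('i%C *: y).
Proof.
by rewrite /rdot hdotZr Re_conji.
Qed.

Lemma hdot_eq x y x' y' : rdot x y = rdot x' y' ->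
  rdot x ('i%C *: y) = rdot x' ('i%C *: y') -> '[x, y] = '[x', y'].
Proof.
rewrite -!Im_hdot /rdot.
by case: '[x, y] => a b; case: '[x', y'] => c d /= -> ->.
Qed.

Lemma hdot_eq0 x y : rdot x y = 0 -> rdot x ('i%C *: y) = 0 -> '[x, y] = 0.
Proof.
by rewrite -Im_hdot /rdot; case: '[x, y] => a b /= -> ->.
Qed.

Lemma rdot_eq0 x : (forall y, rdot x y = 0) -> x = 0.
Proof.
move=> /(_ x)/eqP; rewrite rdotxx sqrf_eq0 => /eqP; exact: rnorm_eq0.
Qed.

Lemma rnormD_sq x y :
  rnorm (x + y) ^+ 2 = rnorm x ^+ 2 + rnorm y ^+ 2 + 2 * rdot x y.
Proof.
rewrite -!rdotxx rdotDl !rdotDr (rdotC y x); ring.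
Qed.

Lemma rnormB_sq x y :
  rnorm (x - y) ^+ 2 = rnorm x ^+ 2 + rnorm y ^+ 2 - 2 * rdot x y.
Proof. by rewrite rnormD_sq rnormN rdotNr mulrN. Qed.

Lemma rdot_le x y : rdot x y <= rnorm x * rnorm y.
Proof.
have [x0|x0] := eqVneq (rnorm x) 0.
  by rewrite (rnorm_eq0 x0) rdot0l rnorm0 mul0r.
have [y0|y0] := eqVneq (rnorm y) 0.
  by rewrite (rnorm_eq0 y0) rdot0r rnorm0 mulr0.
have xy0 : 0 < rnorm x * rnorm y by rewrite mulr_gt0// lt0r ?x0 ?y0 rnorm_ge0.
(* With p = |x| |y|, this square expands to 2p (p - [rdot x y]), and p is positive here. *)
have := sqr_ge0 (rnorm ((rnorm y)%:C%C *: x - (rnorm x)%:C%C *: y)).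
rewrite rnormB_sq !rnormZ rdotZl rdotZr !ger0_norm ?rnorm_ge0// => xy.
rewrite -(ler_pM2l xy0); nra.
Qed.

Lemma rdot_abs x y : `|rdot x y| <= rnorm x * rnorm y.
Proof.
by rewrite ler_norml rdot_le andbT lerNl -rdotNl -(rnormN x) rdot_le.
Qed.

End RealDot.

Lemma rnormZC (R : realType) (V : normedModType R[i]) (a : R[i]) (x : V) :
  rnorm (a *: x) = complex.Re `|a| * rnorm x.
Proof.
apply: complexI; rewrite rmorphM/= -!rnormE normrZ; by rewrite [X in X * _]normc_def.
Qed.

Lemma le_invS_eq0 (R : realType) (r c : R) :
  (forall n : nat, `|r| <= c * n.+1%:R^-1) -> r = 0.
Proof.
move=> rc; apply/eqP/contraT => r0.
have c0 : 0 < c.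
  by have := rc 0; rewrite invr1 mulr1; apply: lt_le_trans; rewrite normr_gt0.
have [n] : exists n : nat, n.+1%:R^-1 < `|r| / c.
  by apply: invS_small; rewrite divr_gt0 ?normr_gt0.
by rewrite ltr_pdivlMr// mulrC ltNge rc.
Qed.

(** * Orthogonal projections *)
Section Projection.
Variables (R : realType) (X : hilbertType R).
Implicit Types (D : set X) (x y w m : X).

Definition linear_subspace D :=
  D 0 /\ forall (a : R[i]) x y, D x -> D y -> D (a *: x + y).

(** The closure of [D], expressed by real distances. *)
Definition adherent D m :=
  forall e : R, 0 < e -> exists2 d, D d & rnorm (m - d) < e.

Definition orthogonal_to D w := forall d, D d -> '[w, d] = 0.

Lemma subspaceZ D (a : R[i]) x : linear_subspace D -> D x -> D (a *: x).
Proof. by move=> [D0 DD] Dx; rewrite -[_ *: _]addr0; exact: DD. Qed.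

Lemma subspaceD D x y : linear_subspace D -> D x -> D y -> D (x + y).
Proof. by move=> [D0 DD] Dx Dy; rewrite -[x]scale1r; exact: DD. Qed.

Lemma adherent_subspace D : linear_subspace D -> linear_subspace (adherent D).
Proof.
move=> [D0 DD]; split.
  by move=> e e0; exists 0 => //; rewrite subrr rnorm0.
move=> a x y Dx Dy e e0.
pose c := complex.Re `|a|.
have c0 : 0 <= c by rewrite -lecR /c normc_def/= lecR sqrtr_ge0.
have [|d Dd xd] := Dx (e / 2 / (c + 1)).
  by rewrite !divr_gt0// ltr_wpDl.
have [|d' Dd' yd] := Dy (e / 2); first by rewrite divr_gt0.
exists (a *: d + d'); first exact: DD.
rewrite opprD addrACA -scalerBr.
apply: le_lt_trans (ler_rnormD _ _) _; rewrite rnormZC -/c.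
rewrite [ltRHS](splitr e) ler_ltD//.
rewrite (le_trans (ler_wpM2l c0 (ltW xd)))//.
by rewrite mulrA ler_pdivrMr ?ltr_wpDl// mulrDr mulr1 mulrC lerDl divr_ge0// ltW.
Qed.

Lemma adherent_orthogonal D w m :
  linear_subspace D -> adherent D m -> orthogonal_to D w -> '[w, m] = 0.
Proof.
move=> sD.
have key m' : adherent D m' -> orthogonal_to D w -> rdot w m' = 0.
  move=> Dm Dw; apply: (@le_invS_eq0 _ _ (rnorm w)) => n.
  have [|d Dd md] := Dm n.+1%:R^-1; first by rewrite invr_gt0.
  rewrite -[m'](subrK d) rdotDr [rdot w d]/rdot Dw// addr0.
  by rewrite (le_trans (rdot_abs _ _))// ler_wpM2l ?rnorm_ge0 ?ltW.
(* The imaginary part is the real part against ['i *: m], which is again adherent to [D]. *)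
move=> Dm Dw; apply: hdot_eq0; apply: key => //.
exact: subspaceZ (adherent_subspace sD) Dm.
Qed.

(** A sequence in [D] minimising the distance to [x] is Cauchy by the parallelogram law; its limit,
    which lies in the closure of [D], is the foot of the perpendicular. *)
Lemma nearest_point D x : linear_subspace D ->
  exists2 m, adherent D m & orthogonal_to D (x - m).
Proof.
move=> sD.
pose E := [set r : R | exists2 d, D d & r = rnorm (x - d) ^+ 2].
have infE : has_inf E.
  split; first by exists (rnorm (x - 0) ^+ 2), 0 => //; exact: sD.1.
  by exists 0 => _ [d _ ->]; exact: sqr_ge0.
pose a := inf E.
have aD d : D d -> a <= rnorm (x - d) ^+ 2.
  by move=> Dd; apply: ge_inf; [exact: infE.2|exists d].
pose s (n : nat) : R := n.+1%:R^-1.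
have s0 n : 0 < s n by rewrite invr_gt0.
(* The excess over the infimum of squared distances is [s n ^+ 2], so that errors in norm are linear
   in [s n]. *)
have /choice[u uP] n : exists d, D d /\ rnorm (x - d) ^+ 2 < a + s n ^+ 2.
  have [_ [d Dd ->] da] := inf_adherent (exprn_gt0 2 (s0 n)) infE.
  by exists d.
have [|e e0|m um] := @complete_rate _ X u (fun n => 2 * s n).
- move=> n k nk; rewrite -(@ler_pXn2r _ 2) ?nnegrE ?rnorm_ge0 ?mulr_ge0 ?(ltW (s0 n))//.
  have [Dn un] := uP n; have [Dk uk] := uP k.
  have kn : s k <= s n by rewrite lef_pV2 ?posrE// ler_nat.
  (* Parallelogram law: the midpoint of [u n] and [u k] lies in [D], so its squared distance to [x]
     is at least [a], which leaves at most 4 [s n ^+ 2] for the squared distance of [u n] and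
     [u k]. *)
  have := rnormD_sq (x - u n) (x - u k); have := rnormB_sq (x - u n) (x - u k).
  have -> : x - u n - (x - u k) = u k - u n by rewrite opprB addrC addrA subrK.
  have -> : x - u n + (x - u k) = 2%:C%C *: (x - 2^-1%:C%C *: (u n + u k)).
    rewrite scalerBr scalerA -rmorphM/= divff// rmorph1 scale1r.
    by rewrite rmorphD/= rmorph1 scalerDl scale1r opprD addrACA.
  have /aD : D (2^-1%:C%C *: (u n + u k)).
    by apply: subspaceZ => //; exact: subspaceD.
  rewrite rnormZ ger0_norm// (rnormB (u k)).
  have : s k ^+ 2 <= s n ^+ 2 by rewrite ler_pXn2r ?nnegrE ?(ltW (s0 _)).
  rewrite !exprMn; move: un uk; lra.
- have [n sn] := invS_small (divr_gt0 e0 (ltr0Sn R 1)).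
  by exists n; rewrite mulrC -ltr_pdivlMr.
exists m.
  move=> e e0; have [n sn] := invS_small (divr_gt0 e0 (ltr0Sn R 1)).
  exists (u n); first exact: (uP n).1.
  by rewrite rnormB (le_lt_trans (um n))// mulrC -ltr_pdivlMr.
suff key d : D d -> rdot (x - m) d = 0.
  by move=> d Dd; apply: hdot_eq0; apply: key => //; exact: subspaceZ.
move=> Dd; have [d0|d0] := eqVneq (rnorm d) 0.
  by rewrite (rnorm_eq0 d0) rdot0r.
(* Of the 3, one unit comes from the near-minimality of [u n] and two from the distance of [u n] to
   [m]. *)
apply: (@le_invS_eq0 _ _ (3 * rnorm d)) => n; rewrite -/(s n).
have [Dn un] := uP n.
have -> : x - m = (x - u n) + (u n - m) by rewrite addrA subrK.
rewrite rdotDl (le_trans (ler_normD _ _))//.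
have -> : 3 * rnorm d * s n = rnorm d * s n + (2 * s n) * rnorm d by ring.
apply: lerD; last first.
  by rewrite (le_trans (rdot_abs _ _))// ler_wpM2r ?rnorm_ge0.
rewrite -(@ler_pXn2r _ 2) ?nnegrE ?mulr_ge0 ?rnorm_ge0 ?(ltW (s0 n))//.
rewrite real_normK ?num_real//.
have dp : 0 < rnorm d ^+ 2 by rewrite exprn_gt0// lt0r d0 rnorm_ge0.
(* This [t] minimises the distance from [x] to the line [u n + t d]; minimality of [a] then bounds
   the gain r^2 / |d|^2 by [s n ^+ 2]. *)
pose t := rdot (x - u n) d / rnorm d ^+ 2.
have /aD : D (u n + t%:C%C *: d) by apply: subspaceD => //; exact: subspaceZ.
rewrite opprD addrA rnormB_sq rnormZ rdotZr exprMn real_normK ?num_real//.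
rewrite /t; set r := rdot _ _ in un *.
have -> : (r / rnorm d ^+ 2) ^+ 2 * rnorm d ^+ 2 = r ^+ 2 / rnorm d ^+ 2.
  by field.
have -> : 2 * (r / rnorm d ^+ 2 * r) = 2 * (r ^+ 2 / rnorm d ^+ 2) by ring.
move=> h; have : r ^+ 2 / rnorm d ^+ 2 < s n ^+ 2 by lra.
by rewrite ltr_pdivrMr// exprMn mulrC => /ltW.
Qed.

(** The difference of two feet of the perpendicular lies in the closure of [D] and is orthogonal to
    it, so the foot is unique. Uniqueness gives linearity, and Pythagoras gives the bound 1. *)
Lemma orthogonal_projection D : linear_subspace D ->
  exists P : {bounded X -> X},
    forall x, adherent D (P x) /\ orthogonal_to D (x - P x).
Proof.
move=> sD; have sA := adherent_subspace sD.
have /choice[f fP] x : exists m, adherent D m /\ orthogonal_to D (x - m).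
  by have [m] := nearest_point x sD; exists m.
have uniq x m : adherent D m -> orthogonal_to D (x - m) -> f x = m.
  move=> Am Om; have [Af Of] := fP x; apply/eqP; rewrite -subr_eq0; apply/eqP.
  have Afm : adherent D (f x - m) by rewrite addrC -scaleN1r; exact: sA.2.
  apply: rnorm_eq0; apply/eqP; rewrite -sqrf_eq0 -rdotxx /rdot.
  rewrite (adherent_orthogonal sD Afm)// => d Dd.
  have -> : f x - m = (x - m) - (x - f x) by rewrite opprB [RHS]addrC addrA subrK.
  by rewrite hdotBl Om// Of// subrr.
have [//|x|P PE] := @bounded_mk _ X X f 1.
- move=> a x y; have [Ax Ox] := fP x; have [Ay Oy] := fP y.
  apply: uniq; first exact: sA.2.
  move=> d Dd; rewrite opprD addrACA -scalerBr hdotDl hdotZl.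
  by rewrite Ox// Oy// mulr0 addr0.
- have [Ax Ox] := fP x; rewrite mul1r.
  rewrite -(@ler_pXn2r _ 2) ?nnegrE ?rnorm_ge0//.
  rewrite -[in leRHS](subrK (f x) x) rnormD_sq /rdot.
  rewrite (adherent_orthogonal sD Ax Ox) mulr0 addr0 lerDr; exact: sqr_ge0.
by exists P => x; rewrite PE.
Qed.

End Projection.

(** * Adjoints *)
Section Adjoint.
Variables (R : realType) (X : hilbertType R).
Implicit Types (x y z w m : X) (D : set X) (T : {bounded X -> X}).

Lemma hdot0l x : '[0, x] = 0.
Proof. exact: linear0l. Qed.

Lemma hdotr_inj u v : (forall x, '[x, u] = '[x, v]) -> u = v.
Proof.
move=> uv; apply/eqP; rewrite -subr_eq0; apply/eqP; apply: rdot_eq0 => x.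
by rewrite rdotC /rdot hdotBr uv subrr.
Qed.

Lemma rdot_i x y : rdot ('i%C *: x) ('i%C *: y) = rdot x y.
Proof. by rewrite /rdot hdotZl hdotZr mulrA; case: '[x, y] => a b /=; ring. Qed.

Lemma rdot_ir x y : rdot x ('i%C *: y) = - rdot ('i%C *: x) y.
Proof.
rewrite -[in RHS]rdot_i scalerA.
have -> : 'i%C * 'i%C = (-1)%:C%C :> R[i] by rewrite -expr2 sqr_i rmorphN.
by rewrite rdotZl mulN1r opprK.
Qed.

(** Continuity of [T] makes the zero set of ['[T _, y]] closed. This serves both for closed kernels
    and for identities that hold on a dense set. *)
Lemma adherent_hdot0 D T m y : adherent D m ->
  (forall d, D d -> '[T d, y] = 0) -> '[T m, y] = 0.
Proof.
move=> Dm.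
have key z : (forall d, D d -> '[T d, z] = 0) -> rdot (T m) z = 0.
  move=> Dz; have [c [c0 cT]] := bounded_bound T.
  apply: (@le_invS_eq0 _ _ (c * rnorm z)) => n.
  have [|d Dd md] := Dm n.+1%:R^-1; first by rewrite invr_gt0.
  rewrite -[m](subrK d) linearD rdotDl [rdot (T d) z]/rdot Dz// addr0.
  rewrite (le_trans (rdot_abs _ _))// mulrAC ler_wpM2r ?rnorm_ge0//.
  by rewrite (le_trans (cT _))// ler_wpM2l// ltW.
move=> Dy; apply: hdot_eq0; apply: key => // d Dd.
by rewrite hdotZr Dy// mulr0.
Qed.

(** Riesz representation of the functional ['[T _, y]]: the component [w] of some [x0] orthogonal to
    its kernel spans the complement of that kernel. *)
Lemma adjoint_vector T y : exists z, forall x, '[T x, y] = '[x, z].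
Proof.
pose D := [set x | '[T x, y] = 0].
have sD : linear_subspace D.
  split; first by rewrite /D/= linear0 hdot0l.
  by move=> a u v; rewrite /D/= linearP hdotDl hdotZl => -> ->; rewrite mulr0 addr0.
have [allD|/existsNP[x0 x0D]] := pselect (forall x, '[T x, y] = 0).
  by exists 0 => x; rewrite allD hdotC hdot0l conjc0.
have [m Am Om] := nearest_point x0 sD.
have Tm : '[T m, y] = 0 by apply: (adherent_hdot0 Am).
pose w := x0 - m; pose a := '[T x0, y].
have Tw : '[T w, y] = a by rewrite linearB hdotBl Tm subr0.
have w0 : '[w, w] != 0.
  rewrite hdot_norm sqrf_eq0 normr_eq0; apply/eqP => w0.
  by apply: x0D; rewrite -/a -Tw w0 linear0 hdot0l.
have a0 : a != 0 by apply/eqP.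
(* The scalar is forced by the value [a] at [w], and conjugated because the second argument is
   conjugate-linear. *)
exists (conjc (a / '[w, w]) *: w) => x; rewrite hdotZr conjcK.
have xD : D (x - ('[T x, y] / a) *: w).
  by rewrite /D/= linearB linearZ hdotBl hdotZl Tw divfK// subrr.
have : '[x - ('[T x, y] / a) *: w, w] = 0 by rewrite hdotC Om// conjc0.
rewrite hdotBl hdotZl => /subr0_eq ->.
by field; rewrite a0 w0.
Qed.

(** |S y|^2 = <T (S y), y> is at most c |S y| |y|. Here [S] is a bare function, since this bound is
    what makes it an operator. *)
Lemma adjoint_bound T (S : X -> X) c : 0 <= c ->
  (forall x, rnorm (T x) <= c * rnorm x) ->
  (forall x y, '[T x, y] = '[x, S y]) -> forall y, rnorm (S y) <= c * rnorm y.
Proof.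
move=> c0 cT TS y; have [->|Sy0] := eqVneq (rnorm (S y)) 0.
  by rewrite mulr_ge0 ?rnorm_ge0.
have Sy : 0 < rnorm (S y) by rewrite lt0r Sy0 rnorm_ge0.
rewrite -(ler_pM2l Sy) -expr2 -rdotxx {1}/rdot -TS.
apply: le_trans (rdot_le _ _) _.
by rewrite mulrCA mulrA ler_wpM2r ?rnorm_ge0.
Qed.

Lemma adjoint_exists T :
  exists S : {bounded X -> X}, forall x y, '[T x, y] = '[x, S y].
Proof.
have /choice[S TS] := adjoint_vector T.
have TS' x y : '[T x, y] = '[x, S y] by exact: TS.
have [c [c0 cT]] := bounded_bound T.
have [|F FE] := @bounded_mk _ X X S c _ (adjoint_bound c0 cT TS').
  move=> a u v; apply: hdotr_inj => x.
  by rewrite hdotDr hdotZr -!TS' hdotDr hdotZr.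
by exists F => x y; rewrite FE.
Qed.

Lemma adjointP T x y : '[T x, y] = '[x, adjoint T y].
Proof.
by have := xgetPex (bounded0 X X) (adjoint_exists T); exact.
Qed.

(** Polarization: the imaginary part of ['[T x, x]] vanishes; expanding it at [x + y] and then
    replacing [y] by ['i *: y] gives symmetry. *)
Lemma positive_sym T : positive_op T -> forall x y, rdot (T x) y = rdot x (T y).
Proof.
move=> T0.
have im0 x : rdot (T x) ('i%C *: x) = 0.
  by have := T0 x; rewrite -Im_hdot lecE/= => /andP[/eqP].
have anti x y : rdot (T x) ('i%C *: y) = - rdot (T y) ('i%C *: x).
  have := im0 (x + y); rewrite linearD scalerDr rdotDl !rdotDr !im0 add0r addr0.
  by move/eqP; rewrite addr_eq0 => /eqP.
move=> x y; have := anti x ('i%C *: y).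
rewrite bounded_linearZ rdot_i scalerA.
have -> : 'i%C * 'i%C = (-1)%:C%C :> R[i] by rewrite -expr2 sqr_i rmorphN.
by rewrite rdotZr mulN1r => /oppr_inj ->; rewrite rdotC.
Qed.

(** By symmetry the imaginary part of ['[T x, x]] equals its own negative. *)
Lemma sym_positive T : (forall x y, rdot (T x) y = rdot x (T y)) ->
  (forall x, 0 <= rdot (T x) x) -> positive_op T.
Proof.
move=> sT T0 x; rewrite lecE/= Im_hdot [X in _ && X]T0 andbT.
have := sT x ('i%C *: x); rewrite bounded_linearZ [RHS]rdot_ir [in RHS]rdotC => h.
by apply/eqP; lra.
Qed.

End Adjoint.

(** * Positive square roots *)
Section SquareRoot.
Variables (R : realType) (X : hilbertType R).
Implicit Types (x y z : X).

Lemma rnorm_le_invS_eq0 (v : X) (c : R) :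
  (forall n : nat, rnorm v <= c * n.+1%:R^-1) -> v = 0.
Proof.
move=> vc; apply: rnorm_eq0; apply: (@le_invS_eq0 _ _ c) => n.
by rewrite ger0_norm ?rnorm_ge0.
Qed.

(** Scalar majorant of [sqrt_iter]; it increases to its fixed point 1. *)
Fixpoint sqrt_rate (n : nat) : R :=
  if n is n'.+1 then 2^-1 * (1 + sqrt_rate n' ^+ 2) else 0.

Local Notation s := sqrt_rate.

Lemma sqrt_rate_bounds n : 0 <= s n /\ s n <= 1.
Proof. by elim: n => [|n [s0 s1]] /=; split; nra. Qed.

Lemma sqrt_rate_nondecreasing n m : (n <= m)%N -> s n <= s m.
Proof.
elim: m => [|m IH]; first by rewrite leqn0 => /eqP->.
rewrite leq_eqVlt => /orP[/eqP->//|]; rewrite ltnS => /IH/le_trans; apply => /=.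
by have := sqr_ge0 (1 - s m); lra.
Qed.

Lemma sqrt_rate_cvg n : 1 - s n <= 2 * n.+1%:R^-1.
Proof.
(* For d = 1 - [s n] the recursion is d - d^2 / 2, increasing on [0, 1]. The shift to [n.+2] keeps
   the bound 2 / (n + 2) inside this interval, with equality at n = 0. *)
have : 1 - s n <= 2 * n.+2%:R^-1.
  elim: n => [|n IH] /=; first by lra.
  have [s0 s1] := sqrt_rate_bounds n.
  set d := 1 - s n in IH *; have d0 : 0 <= d by rewrite subr_ge0.
  have -> : 1 - 2^-1 * (1 + s n ^+ 2) = d - d ^+ 2 / 2 by rewrite /d; field.
  have n2 : 0 < n.+2%:R :> R by [].
  have n3 : n.+3%:R = n.+2%:R + 1 :> R by rewrite -natr1.
  set N : R := n.+2%:R in IH n2 n3 *.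
  have N2 : 2 <= N by rewrite ler_nat.
  apply: (@le_trans _ _ (2 * N^-1 - (2 * N^-1) ^+ 2 / 2)).
    have t1 : 2 * N^-1 <= 1 by rewrite ler_pdivrMr// mul1r.
    by set t := 2 * N^-1 in IH t1 *; nra.
  have -> : 2 * N^-1 - (2 * N^-1) ^+ 2 / 2 = 2 * (N - 1) / N ^+ 2.
    by field; exact: lt0r_neq0.
  rewrite n3 ler_pdivrMr ?exprn_gt0// mulrAC ler_pdivlMr ?addr_gt0//.
  by nra.
move=> /le_trans; apply; rewrite ler_wpM2l// lef_pV2 ?posrE// ler_nat//.
Qed.

(* The iteration solves [L = (B + L^2) / 2], that is [(1 - L)^2 = 1 - B]; it is
   dominated by the same iteration on scalars with [B] replaced by [1]. *)
Fixpoint sqrt_iter (B : X -> X) (n : nat) (x : X) : X :=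
  if n is n'.+1 then
    (2^-1)%:C%C *: (B x + sqrt_iter B n' (sqrt_iter B n' x))
  else 0.

(** The iterates are linear, symmetric and bounded by [s n], and consecutive ones differ by at most
    [s n.+1 - s n]. Telescoping gives a pointwise limit with a rate, through which every property
    passes. *)
Lemma sqrt_fixpoint (B : {bounded X -> X}) :
  (forall x, rnorm (B x) <= rnorm x) ->
  (forall x y, rdot (B x) y = rdot x (B y)) ->
  exists L : {bounded X -> X},
    [/\ forall x, rnorm (L x) <= rnorm x,
        forall x y, rdot (L x) y = rdot x (L y) &
        forall x, L x + L x = B x + L (L x)].
Proof.
move=> B1 symB; pose u := sqrt_iter B.
have s0 n : 0 <= s n by have [] := sqrt_rate_bounds n.
have s1 n : s n <= 1 by have [] := sqrt_rate_bounds n.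
have uS n x : u n.+1 x = (2^-1)%:C%C *: (B x + u n (u n x)) by [].
have ulin n : linear (u n).
  elim: n => [|n IH] a x y; first by rewrite /u/= scaler0 addr0.
  rewrite !uS !IH linearP.
  by rewrite addrACA -scalerDr [LHS]scalerDr !scalerA [a * _]mulrC.
have uB n x y : u n (x - y) = u n x - u n y.
  by rewrite addrC -scaleN1r ulin scaleN1r addrC.
have half_norm x : rnorm ((2^-1)%:C%C *: x) = 2^-1 * rnorm x.
  by rewrite rnormZ ger0_norm// invr_ge0.
have us n x : rnorm (u n x) <= s n * rnorm x.
  elim: n x => [|n IH] x; first by rewrite rnorm0 mul0r.
  rewrite uS half_norm -mulrA ler_wpM2l ?invr_ge0//.
  apply: le_trans (ler_rnormD _ _) _; rewrite mulrDl mul1r lerD ?B1//.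
  by apply: le_trans (IH _) _; rewrite expr2 -mulrA ler_wpM2l.
have u1 n x : rnorm (u n x) <= rnorm x.
  by apply: le_trans (us n x) _; rewrite ler_piMl ?rnorm_ge0.
have usym n x y : rdot (u n x) y = rdot x (u n y).
  elim: n x y => [|n IH] x y; first by rewrite rdot0l rdot0r.
  by rewrite !uS rdotZl rdotZr rdotDl rdotDr symB !IH.
have ustep n x : rnorm (u n.+1 x - u n x) <= (s n.+1 - s n) * rnorm x.
  elim: n x => [|n IH] x.
    rewrite /= !subr0 half_norm; have -> : 1 + 0 ^+ 2 = 1 :> R by ring.
    rewrite mulr1 ler_wpM2l ?invr_ge0//.
    by rewrite (le_trans (ler_rnormD _ _))// rnorm0 addr0.
  (* A difference of squares, split as u' (u' - u) + (u' - u) u; the scalar increment is split in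
     the same way, so the bounds match termwise. *)
  have -> : u n.+2 x - u n.+1 x = (2^-1)%:C%C *:
      (u n.+1 (u n.+1 x - u n x) + (u n.+1 (u n x) - u n (u n x))).
    rewrite uB addrA subrK (uS n.+1) [X in _ - X = _]uS -scalerBr.
    by rewrite opprD addrACA subrr add0r.
  have -> : s n.+2 - s n.+1 =
      2^-1 * (s n.+1 * (s n.+1 - s n) + (s n.+1 - s n) * s n).
    rewrite [s n.+2]/= -/(s n.+1); set t := s n.+1.
    by rewrite {2}/t/= -/(s n); field.
  have ss : 0 <= s n.+1 - s n by rewrite subr_ge0 sqrt_rate_nondecreasing.
  rewrite half_norm -mulrA ler_wpM2l ?invr_ge0//.
  apply: le_trans (ler_rnormD _ _) _; rewrite mulrDl lerD//.
    by apply: le_trans (us _ _) _; rewrite -mulrA ler_wpM2l.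
  by apply: le_trans (IH _) _; rewrite -mulrA ler_wpM2l.
have ucauchy n m x : (n <= m)%N -> rnorm (u n x - u m x) <= (s m - s n) * rnorm x.
  elim: m => [|m IH]; first by rewrite leqn0 => /eqP->; rewrite !subrr rnorm0 mul0r.
  rewrite leq_eqVlt => /orP[/eqP->|]; first by rewrite !subrr rnorm0 mul0r.
  rewrite ltnS => /IH nm; apply: le_trans (ler_rnorm_dist _ (u m x) _) _.
  have := ustep m x; rewrite (rnormB (u m.+1 x)) => mS.
  have -> : (s m.+1 - s n) * rnorm x =
    (s m - s n) * rnorm x + (s m.+1 - s m) * rnorm x by ring.
  exact: lerD.
have /choice[L uL] x : exists l, forall n,
    rnorm (u n x - l) <= 2 * n.+1%:R^-1 * rnorm x.
  apply: (@complete_rate _ X (u ^~ x)) => [n m nm|e e0].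
    apply: le_trans (ucauchy _ _ _ nm) _; rewrite ler_wpM2r ?rnorm_ge0//.
    by apply: le_trans (sqrt_rate_cvg n); rewrite lerB.
  have [n ne] : exists n : nat, n.+1%:R^-1 < e / (2 * (rnorm x + 1)).
    by apply: invS_small; rewrite divr_gt0// mulr_gt0// ltr_wpDl// rnorm_ge0.
  have x0 := rnorm_ge0 x; have x1 : 0 < rnorm x + 1 by rewrite ltr_wpDl.
  have n0 : 0 < n.+1%:R^-1 :> R by rewrite invr_gt0.
  exists n; move: ne; rewrite ltr_pdivlMr ?mulr_gt0//.
  by set t := n.+1%:R^-1 in n0 *; nra.
have L1 x : rnorm (L x) <= 1 * rnorm x.
  rewrite mul1r; apply/ler_addgt0Pr => e e0.
  have x0 := rnorm_ge0 x; have x1 : 0 < rnorm x + 1 by rewrite ltr_wpDl.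
  have [n ne] : exists n : nat, n.+1%:R^-1 < e / (2 * (rnorm x + 1)).
    by apply: invS_small; rewrite divr_gt0// mulr_gt0// ltr_wpDl// rnorm_ge0.
  have n0 : 0 < n.+1%:R^-1 :> R by rewrite invr_gt0.
  move: ne; rewrite ltr_pdivlMr ?mulr_gt0// => ne.
  have := ler_rnormD (u n x) (L x - u n x); rewrite addrC subrK rnormB.
  have := uL x n; have := u1 n x.
  by set t := n.+1%:R^-1 in n0 ne *; nra.
have Llin : linear L.
  move=> a x y; apply/eqP; rewrite -subr_eq0; apply/eqP.
  apply: (@rnorm_le_invS_eq0 _
    (2 * rnorm (a *: x + y) + complex.Re `|a| * 2 * rnorm x + 2 * rnorm y)) => n.
  have -> : L (a *: x + y) - (a *: L x + L y) =
      - (u n (a *: x + y) - L (a *: x + y))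
      + (a *: (u n x - L x) + (u n y - L y)).
    by rewrite scalerBr [in RHS]addrACA ulin opprB -opprD addrA subrK.
  apply: le_trans (ler_rnormD _ _) _; rewrite rnormN.
  have := ler_rnormD (a *: (u n x - L x)) (u n y - L y); rewrite rnormZC.
  have a0 : 0 <= complex.Re `|a| by rewrite normc_def/= sqrtr_ge0.
  have := ler_wpM2l a0 (uL x n); have := uL y n; have := uL (a *: x + y) n.
  by set t := n.+1%:R^-1; lra.
have [LF LE] := bounded_mk Llin L1.
exists LF; split=> [x|x y|x]; rewrite !LE.
- by rewrite -[leRHS]mul1r.
- apply/eqP; rewrite -subr_eq0; apply/eqP.
  apply: (@le_invS_eq0 _ _ (4 * rnorm x * rnorm y)) => n.
  have -> : rdot (L x) y - rdot x (L y) =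
      rdot x (u n y - L y) - rdot (u n x - L x) y.
    by rewrite rdotBr rdotBl usym; ring.
  apply: le_trans (ler_normB _ _) _.
  have := rdot_abs x (u n y - L y); have := rdot_abs (u n x - L x) y.
  have := ler_wpM2l (rnorm_ge0 x) (uL y n).
  have := ler_wpM2r (rnorm_ge0 y) (uL x n).
  by set t := n.+1%:R^-1; lra.
- apply/eqP; rewrite -subr_eq0; apply/eqP.
  (* 8 = 4 + 2 + 2: twice the error of [u n.+1 x], the error of [u n x] under the contraction [u n],
     and the error of [u n] at [L x]. *)
  apply: (@rnorm_le_invS_eq0 _ (8 * rnorm x)) => n.
  have -> : L x + L x - (B x + L (L x)) =
     (- (u n.+1 x - L x) - (u n.+1 x - L x)) +
     (u n (u n x - L x) + (u n (L x) - L (L x))).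
    have uu : u n.+1 x + u n.+1 x = B x + u n (u n x).
      rewrite uS -scalerDl -rmorphD/=.
      by have -> : 2^-1 + 2^-1 = 1 :> R by [field]; rewrite scale1r.
    rewrite uB [u n (u n x) - _ + _]addrA subrK !opprB [L x - _ + _]addrACA -opprD uu.
    by rewrite !opprD !addrA subrK.
  apply: le_trans (ler_rnormD _ _) _.
  have := ler_rnormD (- (u n.+1 x - L x)) (- (u n.+1 x - L x)); rewrite !rnormN.
  have := ler_rnormD (u n (u n x - L x)) (u n (L x) - L (L x)).
  have := u1 n (u n x - L x); have := uL x n; have := uL x n.+1.
  have := uL (L x) n.
  have r0 := rnorm_ge0 (L x); have := L1 x; rewrite mul1r => Lx.
  have n0 : 0 < n.+1%:R^-1 :> R by rewrite invr_gt0.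
  have nS : n.+2%:R^-1 <= n.+1%:R^-1 :> R by rewrite lef_pV2 ?posrE// ler_nat.
  have := ler_wpM2r (rnorm_ge0 x) nS; have := ler_wpM2l (ltW n0) Lx.
  by set t := n.+1%:R^-1 in nS n0 *; set t' := n.+2%:R^-1; lra.
Qed.

(** With [c] a positive bound of [A], the operator B = 1 - c^-2 A^* A is a symmetric contraction. If
    [L] is the fixed point for it, S = c (1 - L) satisfies S^2 = c^2 (1 - B) = A^* A. *)
Lemma sqrt_exists (A : {bounded X -> X}) :
  exists S : {bounded X -> X},
    positive_op S /\ bounded_comp S S = bounded_comp (adjoint A) A.
Proof.
have [c' [c'0 c'A]] := bounded_bound A.
pose c := c' + 1; have c0 : 0 < c by rewrite ltr_wpDl.
have cA x : rnorm (A x) <= c * rnorm x.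
  by apply: le_trans (c'A x) _; rewrite ler_wpM2r ?rnorm_ge0// lerDl.
have cA' := adjoint_bound (ltW c0) cA (adjointP A).
have AA x y : rdot (A x) y = rdot x (adjoint A y) by rewrite /rdot adjointP.
pose t := c^-1 ^+ 2; have t0 : 0 < t by rewrite exprn_gt0// invr_gt0.
have tc : t * c ^+ 2 = 1 by rewrite /t -exprMn mulVf ?expr1n// lt0r_neq0.
pose B x := x - t%:C%C *: adjoint A (A x).
(* |B x|^2 = |x|^2 - 2 t |A x|^2 + t^2 |A^* A x|^2, whose last term is at most t |A x|^2 because t
   c^2 = 1. *)
have B1 x : rnorm (B x) <= 1 * rnorm x.
  rewrite mul1r -(@ler_pXn2r _ 2) ?nnegrE ?rnorm_ge0//.
  rewrite rnormB_sq rnormZ rdotZr -AA rdotxx gtr0_norm// exprMn.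
  have : rnorm (adjoint A (A x)) ^+ 2 <= c ^+ 2 * rnorm (A x) ^+ 2.
    by rewrite -exprMn ler_pXn2r ?nnegrE ?mulr_ge0 ?rnorm_ge0 ?(ltW c0)//.
  move=> /(ler_wpM2l (sqr_ge0 t)).
  have -> : t ^+ 2 * (c ^+ 2 * rnorm (A x) ^+ 2) =
      t * (t * c ^+ 2) * rnorm (A x) ^+ 2 by ring.
  rewrite tc; have := mulr_ge0 (ltW t0) (sqr_ge0 (rnorm (A x))); lra.
have Blin : linear B.
  move=> a x y; rewrite /B (linearP A) (linearP (adjoint A)).
  by rewrite scalerBr [RHS]addrACA -opprD scalerDr !scalerA [a * _]mulrC.
have [BF BE] := bounded_mk Blin B1.
have [x|x y|L [L1 symL LL]] := @sqrt_fixpoint BF.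
- by rewrite BE -[leRHS]mul1r.
- rewrite !BE /B rdotBl rdotBr rdotZl rdotZr -AA.
  by rewrite [rdot (adjoint A _) _]rdotC -AA [rdot (A y) _]rdotC.
pose S x := c%:C%C *: (x - L x).
have Slin : linear S.
  move=> a x y; rewrite /S linearP opprD addrACA -scalerBr scalerDr.
  by rewrite !scalerA mulrC.
have [|SF SE] := @bounded_mk _ X X S (c * 2) Slin.
  move=> x; rewrite rnormZ gtr0_norm// -mulrA ler_wpM2l ?(ltW c0)//.
  by apply: le_trans (ler_rnormD _ _) _; rewrite rnormN; have := L1 x; lra.
exists SF; split.
  apply: sym_positive => [x y|x]; rewrite !SE.
    by rewrite rdotZl rdotZr rdotBl rdotBr symL.
  rewrite rdotZl mulr_ge0 ?(ltW c0)// rdotBl rdotxx subr_ge0.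
  apply: le_trans (rdot_le _ _) _; rewrite expr2.
  by rewrite ler_wpM2r ?rnorm_ge0.
apply: bounded_ext => x; rewrite /bounded_comp/= !SE /S.
rewrite bounded_linearZ -scalerBr scalerA -rmorphM/= (linearB L).
have -> : x - L x - (L x - L (L x)) = x - BF x.
  have -> : BF x = L x + L x - L (L x) by rewrite LL addrK.
  by rewrite -addrA -opprD addrA.
rewrite BE /B opprB addrC subrK scalerA -rmorphM/= -expr2 mulrC tc.
by rewrite rmorph1 scale1r.
Qed.

End SquareRoot.

(** * Extension of densely defined isometries *)
Section IsometricExtension.
Variables (R : realType) (X : hilbertType R) (W : lmodType R[i]).
Implicit Types (f g : W -> X).

Lemma range_subspace f : linear f -> linear_subspace (range f).
Proof.
move=> lf; split.
  have f0 : f 0 = 0 by have := lf (-1) 0 0; rewrite scaler0 addr0 scaleN1r addNr.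
  by exists 0.
by move=> a _ _ [u _ <-] [v _ <-]; exists (a *: u + v) => //; rewrite lf.
Qed.

Lemma dense_range f : linear f ->
  (forall x, (forall w, '[x, f w] = 0) -> x = 0) ->
  forall x, adherent (range f) x.
Proof.
move=> lf f0 x; have [m Am Om] := nearest_point x (range_subspace lf).
suff -> : x = m by [].
apply/eqP; rewrite -subr_eq0; apply/eqP/f0 => w; apply: Om.
by exists w.
Qed.

(** If [f w] runs to [x], equality of norms makes [g w] Cauchy, and its limit is the value at [x].
    The common parameter [w] replaces a map defined on the range of [f]. *)
Lemma isometric_extension f g : linear f -> linear g ->
  (forall w, rnorm (g w) = rnorm (f w)) ->
  (forall x, adherent (range f) x) ->
  exists U : {bounded X -> X},
    (forall w, U (f w) = g w) /\ (forall x, rnorm (U x) = rnorm x).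
Proof.
move=> lf lg gf fd.
have fB w w' : f (w - w') = f w - f w'.
  by rewrite addrC -scaleN1r lf scaleN1r addrC.
have gB w w' : g (w - w') = g w - g w'.
  by rewrite addrC -scaleN1r lg scaleN1r addrC.
pose s (n : nat) : R := n.+1%:R^-1.
have s0 n : 0 < s n by rewrite invr_gt0.
have /choice[U UP] x : exists l, forall n, exists w,
    rnorm (f w - x) <= s n /\ rnorm (g w - l) <= 2 * s n.
  have /choice[w wP] n : exists w, rnorm (f w - x) < s n.
    by have [_ [w _ <-]] := fd x _ (s0 n); rewrite rnormB; exists w.
  have [n m nm|e e0|l gl] := @complete_rate _ X (g \o w) (fun n => 2 * s n).
  - rewrite /= -gB gf fB; apply: le_trans (ler_rnorm_dist _ x _) _.
    have mn : s m <= s n by rewrite lef_pV2 ?posrE// ler_nat.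
    by have := wP n; have := wP m; rewrite (rnormB x); lra.
  - have [n sn] := invS_small (divr_gt0 e0 (ltr0Sn R 1)).
    by exists n; rewrite mulrC -ltr_pdivlMr.
  - by exists l => n; exists (w n); split; [exact/ltW|exact: gl].
(* A value is recognised by simultaneous approximation at any rate [c * s n]; this yields both the
   values on the range of [f] and linearity. The constant adds 2 for [U x], 1 + c for the two
   parameters, and c for [l]. *)
have uniq x l c : (forall n, exists w,
    rnorm (f w - x) <= c * s n /\ rnorm (g w - l) <= c * s n) -> U x = l.
  move=> xl; apply/eqP; rewrite -subr_eq0; apply/eqP.
  apply: (@rnorm_le_invS_eq0 _ _ _ (3 + 2 * c)) => n.
  have [w [fw gw]] := UP x n; have [w' [fw' gw']] := xl n.
  have := ler_rnorm_dist (U x) (g w) l; have := ler_rnorm_dist (g w) (g w') l.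
  have := ler_rnorm_dist (f w) x (f w').
  rewrite -gB gf fB (rnormB (U x) (g w)) (rnormB x (f w')) -/(s n).
  by move: fw gw fw' gw'; lra.
have Uf w : U (f w) = g w.
  by apply: (uniq _ _ 0) => n; exists w; rewrite !subrr rnorm0 mul0r.
have Unorm x : rnorm (U x) = rnorm x.
  apply/eqP; rewrite -subr_eq0; apply/eqP; apply: (@le_invS_eq0 _ _ 3) => n.
  have [w [fw gw]] := UP x n; rewrite -/(s n).
  have := ler_rnormD (U x) (g w - U x); have := ler_rnormD (g w) (U x - g w).
  have := ler_rnormD x (f w - x); have := ler_rnormD (f w) (x - f w).
  rewrite ![_ + (_ - _)]addrC !subrK gf (rnormB (U x)) (rnormB x).
  by rewrite ler_norml; move: fw gw; lra.
have Ulin : linear U.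
  move=> a x y; apply: (uniq _ _ (complex.Re `|a| * 2 + 2)) => n.
  have [v [fv gv]] := UP x n; have [w [fw gw]] := UP y n.
  have a0 : 0 <= complex.Re `|a| by rewrite normc_def/= sqrtr_ge0.
  exists (a *: v + w); rewrite lf lg !opprD ![_ + _ + (- _ - _)]addrACA -!scalerBr.
  have sn := s0 n; split.
    apply: le_trans (ler_rnormD _ _) _; rewrite rnormZC.
    by have := ler_wpM2l a0 fv; have := mulr_ge0 a0 (ltW sn); lra.
  apply: le_trans (ler_rnormD _ _) _; rewrite rnormZC.
  by have := ler_wpM2l a0 gv; lra.
have [|F FE] := @bounded_mk _ X X U 1 Ulin.
  by move=> x; rewrite Unorm mul1r.
by exists F; split => [w|x]; rewrite FE.
Qed.

End IsometricExtension.

(** * Unitary operators from isometries with dense ranges *)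

Section Unitary.
Variables (R : realType) (X : hilbertType R).
Implicit Types (U V : {bounded X -> X}).

Lemma isometry_hdot U : (forall x, rnorm (U x) = rnorm x) ->
  forall x y, '[U x, U y] = '[x, y].
Proof.
move=> Un.
have key x y : rdot (U x) (U y) = rdot x y.
  have := rnormD_sq (U x) (U y); have := rnormD_sq x y.
  by rewrite -linearD !Un; lra.
by move=> x y; apply: hdot_eq; rewrite -?bounded_linearZ key.
Qed.

(** The inverse is the adjoint: <U x, y> = <U x, U (V y)> = <x, V y>. *)
Lemma isometry_unitary U V : (forall x, rnorm (U x) = rnorm x) ->
  cancel U V -> cancel V U -> invertible_op U /\ unitary_op U.
Proof.
move=> Un UV VU.
have UVE : bounded_comp U V = bounded1 X by apply: bounded_ext => x; exact: VU.
have VUE : bounded_comp V U = bounded1 X by apply: bounded_ext => x; exact: UV.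
split; first by exists V.
suff VE : adjoint U = V by rewrite /unitary_op VE.
apply: bounded_ext => y; apply: hdotr_inj => x.
by rewrite -adjointP -[y in LHS]VU isometry_hdot.
Qed.

(** Trivial orthogonal complements make both ranges dense. Extending in both directions gives [U]
    and [V], mutually inverse on these ranges and so everywhere. *)
Lemma unitary_extension (W : lmodType R[i]) (f g : W -> X) :
  linear f -> linear g -> (forall w, rnorm (g w) = rnorm (f w)) ->
  (forall x, (forall w, '[x, f w] = 0) -> x = 0) ->
  (forall x, (forall w, '[x, g w] = 0) -> x = 0) ->
  exists U : {bounded X -> X},
    [/\ forall w, U (f w) = g w, forall x, rnorm (U x) = rnorm x,
        invertible_op U & unitary_op U].
Proof.
move=> lf lg gf f0 g0.
have fd := dense_range lf f0; have gd := dense_range lg g0.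
have [U [Uf Un]] := isometric_extension lf lg gf fd.
have [V [Vg Vn]] := isometric_extension lg lf (fun w => esym (gf w)) gd.
have id_of_dense (h : W -> X) (T S : {bounded X -> X}) :
    (forall x, adherent (range h) x) -> (forall w, S (T (h w)) = h w) ->
    cancel T S.
  move=> hd hK.
  (* The defect of [S \o T] from the identity is packaged as an operator so that [adherent_hdot0]
     applies. *)
  have [D DE] : exists D : {bounded X -> X}, forall x, D x = S (T x) - x.
    have [c [c0 cB]] := bounded_bound (bounded_comp S T).
    apply: (@bounded_mk _ X X (fun x => S (T x) - x) (c + 1)) => [a x y|x].
      by rewrite (linearP T) (linearP S) opprD addrACA -scalerBr.
    apply: le_trans (ler_rnormD _ _) _; rewrite rnormN mulrDl mul1r lerD//.
    exact: cB.
  move=> x; apply/eqP; rewrite -subr_eq0 -DE; apply/eqP.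
  apply: rdot_eq0 => y; rewrite /rdot (adherent_hdot0 (hd x))// => _ [w _ <-].
  by rewrite DE hK subrr hdot0l.
have UV : cancel U V by apply: (id_of_dense f) => // w; rewrite Uf Vg.
have VU : cancel V U by apply: (id_of_dense g) => // w; rewrite Vg Uf.
by have [] := isometry_unitary Un UV VU; exists U.
Qed.

End Unitary.

(** * Generalized index zero *)
Section GeneralizedIndexZero.
Variables (R : realType) (X : hilbertType R) (Z : {bounded X -> X}).
Local Open Scope quotient_scope.

Lemma kernel_projection : exists (k : X -> ker Z) (c : R),
  [/\ linear k, forall x, rnorm (k x) <= c * rnorm x,
      forall x, Z x = 0 -> val (k x) = x &
      forall x, (forall d, Z d = 0 -> '[x, d] = 0) -> k x = 0].
Proof.
pose D := [set x | Z x = 0].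
have sD : linear_subspace D.
  split; first by rewrite /D/= bounded_linear0.
  by move=> a x y; rewrite /D/= bounded_linearP => -> ->; rewrite scaler0 addr0.
have [P PP] := orthogonal_projection sD.
(* The projection lands in the closure of the kernel; continuity of [Z] puts it in the kernel
   itself. *)
have ZP x : Z (P x) = 0.
  apply: hdotr_inj => y; rewrite hdotC [RHS]hdotC hdot0l.
  by rewrite (adherent_hdot0 (PP x).1)// => d Zd; rewrite [Z d]Zd hdot0l.
have kP x : P x \in ker_pred Z by rewrite inE; apply/eqP; exact: ZP.
have [c [c0 cP]] := bounded_bound P.
exists (fun x => Ker (kP x)), c; split.
- by move=> a x y; apply: val_inj; exact: (bounded_linearP P).
- by move=> x; exact: cP.
- move=> x Zx /=; apply/eqP; rewrite eq_sym -subr_eq0; apply/eqP.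
  apply/rnorm_eq0/eqP; rewrite -sqrf_eq0 -rdotxx /rdot (PP x).2//.
  by rewrite /D/= bounded_linearB Zx ZP subrr.
- move=> x xD; apply: val_inj => /=; apply/rnorm_eq0/eqP.
  rewrite -sqrf_eq0 -rdotxx /rdot; apply/eqP.
  have -> : '[P x, P x] = '[x, P x] - '[x - P x, P x].
    by rewrite hdotBl opprB addrC subrK.
  by rewrite xD// (PP x).2 ?subrr//; exact: ZP.
Qed.

(** A class is sent to the component of any representative orthogonal to im Z. If that component
    vanishes, the representative lies in the closure of im Z, which is exactly vanishing of the
    quotient seminorm. *)
Lemma coker_representative : exists (q : coker Z -> X) (c : R),
  [/\ linear q, 0 <= c /\ forall p, rnorm (q p) <= c * complex.Re `|p|,
      forall p u, '[q p, Z u] = 0,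
      forall p, q p = 0 -> `|p| = 0 &
      forall y, (forall u, '[y, Z u] = 0) -> q (\pi_(coker Z) y) = y].
Proof.
have sD : linear_subspace (range Z) by apply: range_subspace => a x y; exact: linearP.
have [P PP] := orthogonal_projection sD.
pose Q x := x - P x.
have Qlin : linear Q.
  by move=> a x y; rewrite /Q bounded_linearP opprD addrACA -scalerBr.
have Qorth x u : '[Q x, Z u] = 0 by apply: (PP x).2; exists u.
have self_orth x : adherent (range Z) x -> orthogonal_to (range Z) x -> x = 0.
  move=> Ax Ox; apply/rnorm_eq0/eqP; rewrite -sqrf_eq0 -rdotxx /rdot.
  by rewrite (adherent_orthogonal sD Ax Ox).
have QZ u : Q (Z u) = 0.
  apply: self_orth; last exact: (PP _).2.
  rewrite /Q addrC -scaleN1r; apply: (adherent_subspace sD).2.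
    exact: (PP _).1.
  by move=> e e0; exists (Z u); rewrite ?subrr ?rnorm0//; exists u.
have Qpi x y : \pi_(coker Z) x = \pi_(coker Z) y -> Q x = Q y.
  move=> /coker_eqP; rewrite inE => -[u _ Zu].
  have -> : x = 1 *: Z u + y by rewrite scale1r [Z u]Zu subrK.
  by rewrite Qlin QZ scaler0 add0r.
have reprE p : \pi_(coker Z) (repr p) = p by rewrite reprK.
pose q (p : coker Z) : X := Q (repr p).
have qpi x : q (\pi_(coker Z) x) = Q x by apply: Qpi; exact: reprE.
have [c [c0 cP]] := bounded_bound P.
have c1 : 0 < 1 + c by rewrite ltr_pwDl.
exists q, (1 + c); split.
- move=> a p p'; rewrite -(reprE p) -(reprE p').
  have -> : a *: \pi_(coker Z) (repr p) + \pi_(coker Z) (repr p') =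
      \pi_(coker Z) (a *: repr p + repr p').
    by rewrite coker_piD -coker_piZ.
  by rewrite !qpi Qlin.
- split=> [|p]; first exact: ltW.
  (* The norm of [p] is an infimum over representatives, and [q p] can be computed from each of
     them. *)
  rewrite mulrC -ler_pdivrMr//.
  apply: lb_le_inf; first by have [] := coset_norms_has_inf p.
  move=> r [y <- yr]; rewrite ler_pdivrMr// qpi.
  have -> : r = rnorm y by apply: complexI; rewrite -yr rnormE.
  apply: le_trans (ler_rnormD _ _) _; rewrite rnormN mulrDr mulr1 lerD//.
  by rewrite mulrC.
- by move=> p u; exact: Qorth.
- move=> p qp.
  have pA : adherent (range Z) (repr p).
    have -> : repr p = P (repr p).
      by apply/eqP; rewrite -subr_eq0; apply/eqP.
    exact: (PP _).1.
  suff /le_anti : 0 <= complex.Re `|p| <= 0.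
    by move=> p0; have -> : `|p| = (complex.Re `|p|)%:C%C by []; rewrite -p0.
  apply/andP; split; first by rewrite -lecR; exact: coker_norm_ge0.
  apply/ler_addgt0Pr => e e0; rewrite add0r.
  have [_ [u _ <-] /ltW pu] := pA _ e0; apply: le_trans pu.
  have pE : p = \pi_(coker Z) (repr p - Z u).
    rewrite -[LHS]reprE; apply/coker_eqP; rewrite opprB addrC subrK inE.
    by exists u.
  rewrite [in leLHS]pE -lecR -rnormE; exact: coker_norm_pi_le.
- move=> y yZ; rewrite qpi /Q.
  suff -> : P y = 0 by rewrite subr0.
  apply: self_orth; first exact: (PP y).1.
  have -> : P y = y - Q y by rewrite /Q opprB addrC subrK.
  by move=> _ [u _ <-]; rewrite hdotBl yZ Qorth subrr.
Qed.

Variable theta : {linear ker Z -> coker Z}.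

Lemma continuous_coker_bound : continuous theta ->
  exists2 c : R, 0 <= c & forall k, complex.Re `|theta k| <= c * rnorm k.
Proof.
move=> ct.
have /nbhs_ballP[d d0 dB] : nbhs (0 : ker Z) (theta @^-1` ball (theta 0) 1).
  by apply: ct; exact: nbhsx_ballx.
pose e := complex.Re d; have dE : d = e%:C%C := posC_real d0.
have e0 : 0 < e by rewrite -ltcR -dE.
have thetaZ (r : R) k : 0 <= r ->
    complex.Re `|theta (r%:C%C *: k)| = r * complex.Re `|theta k|.
  move=> r0; rewrite linearZ_LR.
  have -> : `|r%:C%C *: theta k| = `|r%:C%C| * `|theta k|.
    by exact: coker_normrZ.
  by rewrite ger0_norm ?lecR// ReZ.
exists (2 / e); first by rewrite divr_ge0 ?ltW.
move=> k; have [k0|k0] := eqVneq (rnorm k) 0.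
  rewrite k0 (rnorm_eq0 k0) mulr0.
  have := thetaZ 0 0 (lexx _); rewrite scaler0 mul0r => ->//.
have k1 : 0 < rnorm k by rewrite lt0r k0 rnorm_ge0.
(* Rescales [k] to norm [e / 2], inside the ball of radius [e] given by continuity at 0. *)
pose r := e / (2 * rnorm k).
have r0 : 0 < r by rewrite divr_gt0// mulr_gt0.
have : ball (theta 0) 1 (theta (r%:C%C *: k)).
  apply: dB; rewrite -ball_normE/= sub0r normrN rnormE dE ltcR rnormZ gtr0_norm//.
  by rewrite /r invfM mulrA mulfVK// ltr_pdivrMr// ltr_pMr// ltr1n.
rewrite /ball/= linear0 sub0r normrN => h.
have : complex.Re `|theta (r%:C%C *: k)| < 1.
  by move: h; rewrite ltcE/= => /andP[].
rewrite thetaZ ?(ltW r0)// => rk.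
have -> : 2 / e * rnorm k = r^-1.
  by rewrite /r; field; rewrite k0 lt0r_neq0.
by rewrite -[leRHS]div1r ler_pdivlMr// mulrC ltW.
Qed.

(** A point of seminorm zero lies in every ball around 0, so continuity sends it into every ball
    around 0 of the normed space [ker Z]. This is how closedness of im Z enters. *)
Lemma continuous_coker_separated (thetaV : coker Z -> ker Z) :
  cancel theta thetaV -> continuous thetaV ->
  forall p, `|p| = 0 -> thetaV p = 0.
Proof.
move=> thK cV p p0.
have V0 : thetaV 0 = 0 by rewrite -[X in thetaV X](linear0 theta) thK.
apply: normr0_eq0; apply/eqP/contraT => tp.
have t0 : 0 < `|thetaV p| by rewrite normr_gt0 -normr_eq0.
have /(cV 0)/nbhs_ballP[d d0 dB] := nbhsx_ballx (thetaV 0) _ t0.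
have : ball (thetaV 0) `|thetaV p| (thetaV p).
  by apply: dB; rewrite /ball/= sub0r normrN p0.
by rewrite V0 -ball_normE/= sub0r normrN ltxx.
Qed.

Lemma kernel_to_range_complement : continuous_isomorphism theta ->
  exists T : {bounded X -> X},
  [/\ forall u v, '[T u, Z v] = 0,
      forall x, Z x = 0 -> T x = 0 -> x = 0,
      forall x, (forall d, Z d = 0 -> '[x, d] = 0) -> T x = 0 &
      forall y, (forall u, '[y, Z u] = 0) -> (forall u, '[y, T u] = 0) -> y = 0].
Proof.
move=> [ct [thetaV [thK thVK cV]]].
have [k [c [klin kc kid k0]]] := kernel_projection.
have [q [c' [qlin [c'0 qc] qorth q0 qid]]] := coker_representative.
have [c'' c''0 thc] := continuous_coker_bound ct.
have [||T TE] := @bounded_mk _ X X (q \o theta \o k) (c' * (c'' * c)).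
- by move=> a x y; rewrite /= klin (linearP theta) qlin.
- move=> x /=; apply: le_trans (qc _) _;
  rewrite -mulrA ler_wpM2l//; apply: le_trans (thc _) _.
  by rewrite -mulrA ler_wpM2l.
exists T; split.
- by move=> u v; rewrite TE qorth.
- move=> x Zx; rewrite TE => /q0 /(continuous_coker_separated thK cV).
  by rewrite thK => kx; rewrite -(kid _ Zx) kx raddf0.
- move=> x /k0 kx; rewrite TE/= kx linear0.
  by have := qlin (-1) 0 0; rewrite scaler0 addr0 scaleN1r addNr.
(* Being orthogonal to im Z, [y] is the representative of its own class, hence equals [T] at the
   preimage of that class under [theta]; so it is orthogonal to itself. *)
- move=> y yZ yT; have := yT (val (thetaV (\pi_(coker Z) y))).
  have Zv : Z (val (thetaV (\pi_(coker Z) y))) = 0.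
    by apply/eqP; exact: (valP (thetaV _)).
  have kv : k (val (thetaV (\pi_(coker Z) y))) = thetaV (\pi_(coker Z) y).
    by apply: val_inj; exact: kid.
  rewrite TE/= kv thVK qid// => yy.
  by apply/rnorm_eq0/eqP; rewrite -sqrf_eq0 -rdotxx /rdot yy.
Qed.

End GeneralizedIndexZero.

(** * Assembly of the polar decomposition *)

Theorem theorem1p13 (R : realType) (X : hilbertType R) (Z : {bounded X -> X})
    (theta : {linear ker Z -> coker Z}) :
  continuous_isomorphism theta ->
  exists U : {bounded X -> X},
    [/\ invertible_op U,
        partial_isometry U,
        Z = bounded_comp U (sqrt_op (bounded_comp (adjoint Z) Z)) &
        isometric theta -> unitary_op U].
Proof.
move=> /kernel_to_range_complement[T [TZ T0 TK TD]].
(* |S x|^2 = <x, S^2 x> = <x, A^* A x> = |A x|^2. *)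
have sqrt_norm (A S : {bounded X -> X}) : positive_op S ->
    bounded_comp S S = bounded_comp (adjoint A) A ->
    forall x, rnorm (S x) = rnorm (A x).
  move=> S0 SS x; apply/eqP; rewrite -(@eqrXn2 _ 2) ?rnorm_ge0//.
  rewrite -!rdotxx positive_sym//.
  have -> : S (S x) = adjoint A (A x).
    by have := congr1 (fun F : {bounded X -> X} => F x) SS.
  by rewrite /rdot -adjointP.
have [H0 HH] : positive_op (sqrt_op (bounded_comp (adjoint Z) Z)) /\
    bounded_comp (sqrt_op (bounded_comp (adjoint Z) Z))
      (sqrt_op (bounded_comp (adjoint Z) Z)) = bounded_comp (adjoint Z) Z.
  by have := xgetPex (bounded0 X X) (sqrt_exists Z); exact.
set H := sqrt_op _ in H0 HH *.
have [K [K0 KK]] := sqrt_exists T.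
have Hn := sqrt_norm _ _ H0 HH; have Kn := sqrt_norm _ _ K0 KK.
have Hsym := positive_sym H0; have Ksym := positive_sym K0.
(* [H] is symmetric and vanishes on ker Z, so its values are orthogonal to ker Z, where [T] and
   hence [K] vanish. *)
have KH x : K (H x) = 0.
  apply: rnorm_eq0; rewrite Kn TK ?rnorm0// => d Zd.
  have Hd e : Z e = 0 -> rdot (H x) e = 0.
    move=> Ze; rewrite Hsym (rnorm_eq0 (_ : rnorm (H e) = 0)) ?rdot0r//.
    by rewrite Hn Ze rnorm0.
  by apply: hdot_eq0; apply: Hd; rewrite ?bounded_linearZ Zd ?scaler0.
pose f (w : X * X) : X := H w.1 + K w.2.
pose g (w : X * X) : X := Z w.1 + T w.2.
have [|||x xf|y yg|U [Ufg Un Ui Uu]] := @unitary_extension _ X _ f g.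
- by move=> a [u v] [u' v']; rewrite /f/= !bounded_linearP scalerDr addrACA.
- by move=> a [u v] [u' v']; rewrite /g/= !bounded_linearP scalerDr addrACA.
(* Both cross terms vanish: <H u, K v> = <K (H u), v> = 0, and <Z u, T v> = 0 by [TZ]. *)
- move=> [u v]; apply/eqP; rewrite -(@eqrXn2 _ 2) ?rnorm_ge0// /f /g/= !rnormD_sq.
  rewrite Hn Kn -Ksym KH rdot0l [rdot (Z u) _]rdotC {1}/rdot TZ//.
(* By symmetry, orthogonality to both ranges means that [H] and [K] kill [x]; then so do [Z] and
   [T], and [T] is injective on ker Z. *)
- have Hx : H x = 0.
    apply: rdot_eq0 => u; rewrite Hsym.
    have := xf (u, 0); rewrite /f/= bounded_linear0 addr0 /rdot => ->//.
  have Kx : K x = 0.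
    apply: rdot_eq0 => u; rewrite Ksym.
    have := xf (0, u); rewrite /f/= bounded_linear0 add0r /rdot => ->//.
  by apply: T0; apply: rnorm_eq0; rewrite -?Hn -?Kn ?Hx ?Kx rnorm0.
- apply: TD => u.
    by have := yg (u, 0); rewrite /g/= bounded_linear0 addr0.
  by have := yg (0, u); rewrite /g/= bounded_linear0 add0r.
exists U; split=> //.
  by move=> x _; rewrite !rnormE Un.
apply: bounded_ext => x; rewrite /bounded_comp/=.
by have := Ufg (x, 0); rewrite /f /g/= !bounded_linear0 !addr0.
Qed.
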